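(* Let $K\ge3$, $N\ge 2$, $\theta>0$, $p>0$, and let $\nu_N$ be the stationary distribution of the $N$-particle process on $\mathcal{E}_{K,N}$ with generator $\mathcal{L}_{K,N}$. For every $k\in\mathbb{Z}/K\mathbb{Z}$, \[ \operatorname{Cov}_{\nu_N}\left[\frac{\eta(0)}{N},\frac{\eta(k)}{N}\right]=\operatorname{Cov}_{\nu_N}\left[\frac{\eta(0)}{N},\frac{\eta(K-k)}{N}\right]. \]
   Context: $\mathcal{E}_{K,N}=\{\eta:\mathbb{Z}/K\mathbb{Z}\to\mathbb{N},\ \sum_{k}\eta(k)=N\}$ ($\mathbb{N}$ includes $0$; site indices are modulo $K$). The generator is \[ (\mathcal{L}_{K,N}f)(\eta)=\sum_{i,j\in\mathbb{Z}/K\mathbb{Z}}\eta(i)\left(\mathbf{1}_{\{j=i+1\}}+\theta\,\mathbf{1}_{\{j=i-1\}}+p\frac{\eta(j)}{N-1}\right)[f(T_{i\to j}\eta)-f(\eta)], \] with $T_{i\to j}\eta=\eta-\mathbf{e}_i+\mathbf{e}_j$ (when $\eta(i)>0$). The process is irreducible and $\nu_N$ is its unique stationary distribution; $\operatorname{Cov}_{\nu_N}$ is the covariance when $\eta$ has law $\nu_N$. *)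

(* Defs.v *)
From HB Require Import structures.
From mathcomp Require Import all_boot all_order all_algebra.
From mathcomp Require Import reals.

Set Implicit Arguments.
Unset Strict Implicit.
Unset Printing Implicit Defensive.

Import Order.TTheory GRing.Theory Num.Theory.
Local Open Scope ring_scope.

(* Configurations of N particles on Z/KZ. Bounding each occupation number by
   N loses nothing (see config_surj) and makes the state space a finType.
   'Z_K is Z/KZ only for K >= 2. *)
Record config (K N : nat) := Config {
  occ :> {ffun 'Z_K -> 'I_N.+1};
  _ : (\sum_(k : 'Z_K) (occ k : nat) == N)%N
}.

HB.instance Definition _ (K N : nat) := [isSub for @occ K N].
HB.instance Definition _ (K N : nat) := [Finite of config K N by <:].

Lemma config_sum (K N : nat) (eta : config K N) :
  (\sum_(k : 'Z_K) (eta k : nat) = N)%N.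
Proof. by apply/eqP; case: eta. Qed.

Lemma config_surj (K N : nat) (g : 'Z_K -> nat) :
  (\sum_(k : 'Z_K) g k = N)%N ->
  exists eta : config K N, forall k, (eta k : nat) = g k.
Proof.
move=> sg.
have gN k : (g k < N.+1)%N by rewrite ltnS -sg (bigD1 k) //= leq_addr.
have h : (\sum_(k : 'Z_K) ([ffun k => inord (g k)] : {ffun 'Z_K -> 'I_N.+1}) k
          == N)%N.
  by apply/eqP; rewrite -[RHS]sg; apply: eq_bigr => k _; rewrite ffunE inordK.
by exists (Config h) => k; rewrite /= ffunE inordK.
Qed.

(* T_{i -> j} eta = eta - e_i + e_j when eta i > 0 (see moveE); the value is
   irrelevant when eta i = 0, where the jump has rate 0. *)
Definition move (K N : nat) (i j : 'Z_K) (eta : config K N) : config K N :=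
  insubd eta [ffun l : 'Z_K => inord (eta l - (l == i) + (l == j))%N].

Lemma moveE (K N : nat) (i j : 'Z_K) (eta : config K N) (l : 'Z_K) :
  (0 < eta i)%N ->
  (move i j eta l : nat) = (eta l - (l == i) + (l == j))%N.
Proof.
move=> i0; set g := fun l : 'Z_K => (eta l - (l == i) + (l == j))%N.
have sg : (\sum_l g l = N)%N.
  have d (m : 'Z_K) : (\sum_(l : 'Z_K) (l == m) = 1)%N.
    by rewrite (bigD1 m) //= eqxx big1 // => k /negbTE ->.
  suff e : (\sum_l g l + \sum_(l : 'Z_K) (l == i) =
            \sum_(l : 'Z_K) eta l + \sum_(l : 'Z_K) (l == j))%N.
    by move: e; rewrite !d config_sum => /addIn.
  rewrite -!big_split /=; apply: eq_bigr => k _.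
  rewrite /g addnAC; congr (_ + _)%N; apply: subnK.
  by case: eqP => // ->.
have [e eE] := config_surj sg.
have -> : move i j eta = e.
  apply: val_inj; rewrite /move val_insubd /=.
  have -> : [ffun l : 'Z_K => inord (g l)] = occ e.
    by apply/ffunP => k; rewrite ffunE -eE inord_val.
  by rewrite (valP e).
exact: eE.
Qed.

Definition generator (R : realType) (K N : nat) (theta p : R)
    (f : config K N -> R) (eta : config K N) : R :=
  \sum_(i : 'Z_K) \sum_(j : 'Z_K)
    (eta i)%:R *
    ((j == i + 1)%:R + theta * (j == i - 1)%:R
       + p * ((eta j)%:R / (N%:R - 1))) *
    (f (move i j eta) - f eta).

Definition distribution (R : realType) (T : finType) (nu : T -> R) : Prop :=
  (forall x, 0 <= nu x) /\ \sum_x nu x = 1.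

Definition expectation (R : realType) (T : finType) (nu X : T -> R) : R :=
  \sum_x nu x * X x.

Definition covariance (R : realType) (T : finType) (nu X Y : T -> R) : R :=
  expectation nu (fun x => (X x - expectation nu X) * (Y x - expectation nu Y)).

Definition stationary_distribution (R : realType) (K N : nat) (theta p : R)
    (nu : config K N -> R) : Prop :=
  distribution nu /\
  forall f : config K N -> R, expectation nu (generator theta p f) = 0.

(* Main.v *)
Require Import Defs.
From mathcomp Require Import all_boot all_order all_algebra.
From mathcomp Require Import reals.
From mathcomp Require Import ring lra.

Import Order.TTheory GRing.Theory Num.Theory.
Local Open Scope ring_scope.

(** The result follows from translation invariance of the two-site correlations
    [S a b = E(eta a * eta b)]: invariance gives [S 0 k = S (- k) 0], and [S]
    is symmetric. Invariance of [S] is read off from the linear equations that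
    stationarity imposes on the first two moments.

    The interaction is a Moran-type resampling: for each ordered pair of
    particles, the first is moved onto the second at rate [p / (N - 1)]. Its
    net effect on the mean occupation of a site cancels, because the pairs
    [(i, a)] that feed [a] and the pairs [(a, j)] that empty it have equal
    total rates. Hence the generator maps polynomials in the occupation numbers
    of degree at most 1, resp. 2, to polynomials of the same degree, and
    testing stationarity against them closes ([generator_occ],
    [generator_occ2]).

    - In degree 1, the mean occupation is harmonic for an asymmetric nearest
      neighbour walk on the cycle, hence constant ([mean_occ_cst]).
    - In degree 2, [S] solves the equation of two independent walks with a
      killing term [- 2 p / (N - 1) * S], coming from the resampling between
      the two sites observed, and with a source that is linear in the mean
      occupations. As these are constant, the source depends on [a - b] only.
      So [S (a + 1) (b + 1) - S a b] solves the homogeneous equation, and the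
      killing term forces it to vanish by the maximum principle
      ([massive_harmonic_eq0], [occ_corr_shift]). *)

(** * Expectation and covariance on a finite space *)

Section Expectation.
Context {R : realType} {T : finType}.
Implicit Types (nu X Y : T -> R).

Lemma eq_expectation nu X Y :
  X =1 Y -> expectation nu X = expectation nu Y.
Proof. by move=> e; apply: eq_bigr => x _; rewrite e. Qed.

Lemma expectationD nu X Y :
  expectation nu (fun x => X x + Y x) = expectation nu X + expectation nu Y.
Proof. by rewrite -big_split; apply: eq_bigr => x _; rewrite mulrDr. Qed.

Lemma expectationZ nu (c : R) X :
  expectation nu (fun x => c * X x) = c * expectation nu X.
Proof. by rewrite /expectation mulr_sumr; apply: eq_bigr => x _; rewrite mulrCA. Qed.

Lemma expectation_cst nu (c : R) :
  distribution nu -> expectation nu (fun=> c) = c.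
Proof. by case=> _ nu1; rewrite /expectation -mulr_suml nu1 mul1r. Qed.

Lemma covarianceE nu X Y : distribution nu ->
  covariance nu X Y =
  expectation nu (fun x => X x * Y x) - expectation nu X * expectation nu Y.
Proof.
move=> dnu; rewrite /covariance.
set mX := expectation nu X; set mY := expectation nu Y.
under eq_expectation => x.
  have -> : (X x - mX) * (Y x - mY) =
            X x * Y x + (- mY * X x + (- mX * Y x + mX * mY)) by ring.
  over.
by rewrite !expectationD !expectationZ expectation_cst // -/mX -/mY; ring.
Qed.

End Expectation.

(** * Maximum principles on the cycle and on the discrete torus *)

Section MaximumPrinciple.
Context {R : realType} {K : nat}.

(** At a maximum [M] both neighbours must be maxima too; stepping repeatedly
    from [M] to [M - 1] reaches the whole cycle. *)
Lemma cyclic_harmonic_cst (theta : R) (m : 'Z_K -> R) : 0 < theta ->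
  (forall a, m (a - 1) + theta * m (a + 1) - (1 + theta) * m a = 0) ->
  forall a b, m a = m b.
Proof.
move=> theta0 harm.
pose M := [arg max_(i > (0 : 'Z_K)) m i]%O.
have maxM i : m i <= m M.
  by rewrite /M; case: Order.TotalTheory.arg_maxP => // j _; apply.
have propagate n : m (M - n%:R) = m M.
  elim: n => [|n IHn]; first by rewrite subr0.
  apply/le_anti; rewrite maxM /=.
  have := harm (M - n%:R); rewrite IHn.
  have := maxM (M - n%:R + 1).
  rewrite -natr1 opprD addrA => le1 eq0.
  have : theta * m (M - n%:R + 1) <= theta * m M by rewrite ler_pM2l.
  lra.
suff all_max a : m a = m M by move=> a b; rewrite !all_max.
by rewrite -(propagate (M - a : 'Z_K)) natr_Zp opprB addrC subrK.
Qed.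

(** At a maximum of [u] the left-hand side, which generates two independent
    walks, is nonpositive, whereas the right-hand side has the sign of [u]. *)
Lemma massive_harmonic_le0 (theta c : R) (u : 'Z_K -> 'Z_K -> R) :
  0 < theta -> 0 < c ->
  (forall a b, u (a - 1) b + theta * u (a + 1) b + u a (b - 1)
     + theta * u a (b + 1) - 2 * (1 + theta) * u a b = c * u a b) ->
  forall a b, u a b <= 0.
Proof.
move=> theta0 c0 eqn a b.
pose M := [arg max_(i > ((0, 0) : 'Z_K * 'Z_K)) u i.1 i.2]%O.
have maxM i j : u i j <= u M.1 M.2.
  by rewrite /M; case: Order.TotalTheory.arg_maxP => // x _ /(_ (i, j)); apply.
apply: (le_trans (maxM a b)).
rewrite -(pmulr_rle0 _ c0) -eqn.
have le1 := maxM (M.1 - 1) M.2.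
have le2 := maxM M.1 (M.2 - 1).
have : theta * u (M.1 + 1) M.2 <= theta * u M.1 M.2 by rewrite ler_pM2l.
have : theta * u M.1 (M.2 + 1) <= theta * u M.1 M.2 by rewrite ler_pM2l.
lra.
Qed.

Lemma massive_harmonic_eq0 (theta c : R) (u : 'Z_K -> 'Z_K -> R) :
  0 < theta -> 0 < c ->
  (forall a b, u (a - 1) b + theta * u (a + 1) b + u a (b - 1)
     + theta * u a (b + 1) - 2 * (1 + theta) * u a b = c * u a b) ->
  forall a b, u a b = 0.
Proof.
move=> theta0 c0 eqn a b; apply/le_anti/andP; split.
  exact: massive_harmonic_le0 eqn a b.
rewrite -oppr_le0.
apply: (@massive_harmonic_le0 theta c (fun i j => - u i j)) => // i j.
by rewrite !mulrN -eqn; ring.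
Qed.

End MaximumPrinciple.

(** * The generator on polynomials of degree one and two *)

Section GeneratorOnPolynomials.
Context {R : realType} {K N : nat} (theta p : R).
Implicit Types (eta : config K N) (i j a b : 'Z_K).

Definition jump_rate eta i j : R :=
  (j == i + 1)%:R + theta * (j == i - 1)%:R + p * ((eta j)%:R / (N%:R - 1)).

Lemma sum_delta (F : 'Z_K -> R) a : \sum_i F i * (a == i)%:R = F a.
Proof.
rewrite (bigD1 a) //= eqxx mulr1 big1 ?addr0 // => i.
by rewrite eq_sym => /negbTE ->; rewrite mulr0.
Qed.

Lemma sum_occ eta : \sum_i (eta i)%:R = N%:R :> R.
Proof. by rewrite -natr_sum config_sum. Qed.

(** The interaction adds to the inflow at [a] exactly [p N / (N - 1)] per
    particle present at [a], the same constant as in the departure rate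
    [outrateE]. This is why it disappears from [generator_occ]. *)
Lemma inflowE eta a :
  \sum_i (eta i)%:R * jump_rate eta i a =
  (eta (a - 1))%:R + theta * (eta (a + 1))%:R
    + p * N%:R / (N%:R - 1) * (eta a)%:R.
Proof.
under eq_bigr => i _.
  (* Write the adjacency conditions as i = a - 1 and i = a + 1, to sum over i. *)
  rewrite /jump_rate -(subr_eq a i 1) -(subr_eq a i (-1)) opprK.
  rewrite mulrDr mulrDr (mulrCA _ theta).
  over.
rewrite !big_split /= -mulr_sumr !sum_delta -mulr_suml sum_occ.
by congr (_ + _); ring.
Qed.

Lemma outrateE eta a :
  \sum_j jump_rate eta a j = 1 + theta + p * N%:R / (N%:R - 1).
Proof.
rewrite /jump_rate !big_split /= -!mulr_sumr -mulr_suml sum_occ mulrA.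
congr (_ + _ + _).
  under eq_bigr do rewrite eq_sym -[_%:R]mul1r.
  exact: sum_delta.
rewrite -[RHS]mulr1; congr (_ * _).
under eq_bigr do rewrite eq_sym -[_%:R]mul1r.
exact: sum_delta.
Qed.

Lemma move_natr eta i j a : (0 < eta i)%N ->
  (move i j eta a)%:R = (eta a)%:R + ((a == j)%:R - (a == i)%:R) :> R.
Proof.
move=> i0; rewrite moveE // natrD natrB; first by ring.
by case: eqP => // ->.
Qed.

Lemma generator_occ eta a :
  generator theta p (fun xi : config K N => (xi a)%:R) eta =
  (eta (a - 1))%:R + theta * (eta (a + 1))%:R - (1 + theta) * (eta a)%:R.
Proof.
transitivity (\sum_i \sum_j (eta i)%:R * jump_rate eta i j
                * ((a == j)%:R - (a == i)%:R)).
  apply: eq_bigr => i _; apply: eq_bigr => j _; rewrite -/(jump_rate eta i j).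
  (* Jumps out of an empty site have rate zero, so both sides vanish. *)
  case: (posnP (eta i)) => [-> | i0]; first by rewrite !mul0r.
  by rewrite move_natr // addrC addKr.
under eq_bigr do under eq_bigr do rewrite mulrBr.
under eq_bigr do rewrite sumrB sum_delta -mulr_suml.
rewrite sumrB sum_delta inflowE -mulr_sumr outrateE.
by ring.
Qed.

Definition hop_kernel i j : R := (j == i + 1)%:R + theta * (j == i - 1)%:R.

(** Carre-du-champ computation: the generator satisfies the Leibniz rule up to
    the sum over jumps of the product of the two increments. That sum carries
    the killing term [- 2 p / (N - 1) * (eta a * eta b)], from the jumps between
    [a] and [b]; all its other contributions are linear in [eta], with
    coefficients depending on [a - b] only. *)
Lemma generator_occ2 eta a b :
  generator theta p (fun xi : config K N => (xi a)%:R * (xi b)%:R) eta =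
  (eta (a - 1))%:R * (eta b)%:R + theta * ((eta (a + 1))%:R * (eta b)%:R)
  + (eta a)%:R * (eta (b - 1))%:R + theta * ((eta a)%:R * (eta (b + 1))%:R)
  - 2 * (1 + theta) * ((eta a)%:R * (eta b)%:R)
  - 2 * p / (N%:R - 1) * ((eta a)%:R * (eta b)%:R)
  + ((a == b)%:R * ((eta (a - 1))%:R + theta * (eta (a + 1))%:R
        + (1 + theta + 2 * p * N%:R / (N%:R - 1)) * (eta a)%:R)
     - hop_kernel a b * (eta a)%:R - hop_kernel b a * (eta b)%:R).
Proof.
pose w i j := (eta i)%:R * jump_rate eta i j.
transitivity (
  (eta a)%:R * generator theta p (fun xi : config K N => (xi b)%:R) eta
  + (eta b)%:R * generator theta p (fun xi : config K N => (xi a)%:R) eta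
  + \sum_i \sum_j w i j * (((a == j)%:R - (a == i)%:R)
                             * ((b == j)%:R - (b == i)%:R))).
  rewrite /generator !mulr_sumr -!big_split; apply: eq_bigr => i _ /=.
  rewrite !mulr_sumr -!big_split; apply: eq_bigr => j _ /=.
  rewrite /w -/(jump_rate eta i j).
  case: (posnP (eta i)) => [-> | i0]; first by rewrite !(mul0r, mulr0, addr0).
  by rewrite !move_natr //; ring.
have -> : \sum_i \sum_j w i j * (((a == j)%:R - (a == i)%:R)
                             * ((b == j)%:R - (b == i)%:R)) =
  (a == b)%:R * (\sum_i w i a + \sum_j w a j) - w a b - w b a.
  under eq_bigr => i _.
    under eq_bigr => j _.
      have -> : w i j * (((a == j)%:R - (a == i)%:R)
                             * ((b == j)%:R - (b == i)%:R)) =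
        w i j * (b == j)%:R * (a == j)%:R - w i j * (b == i)%:R * (a == j)%:R
        - w i j * (a == i)%:R * (b == j)%:R + w i j * (b == i)%:R * (a == i)%:R
        by ring.
      over.
    rewrite big_split !sumrB /= !sum_delta -!mulr_suml.
    over.
  rewrite big_split !sumrB /= !sum_delta -!mulr_suml.
  by rewrite (eq_sym b a); ring.
rewrite /w inflowE -mulr_sumr outrateE !generator_occ /jump_rate.
rewrite -/(hop_kernel a b) -/(hop_kernel b a).
by case: eqP => [<-|_]; rewrite ?mul0r ?mul1r; ring.
Qed.

End GeneratorOnPolynomials.

(** * Moments of a stationary distribution *)

Section StationaryMoments.
Context {R : realType} {K N : nat} {theta p : R} {nu : config K N -> R}.
Hypotheses (theta0 : 0 < theta) (p0 : 0 < p) (N2 : (2 <= N)%N).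
Hypothesis stat : stationary_distribution theta p nu.

Definition mean_occ (nu : config K N -> R) (a : 'Z_K) :=
  expectation nu (fun eta => (eta a)%:R).

Definition occ_corr (nu : config K N -> R) (a b : 'Z_K) :=
  expectation nu (fun eta => (eta a)%:R * (eta b)%:R).

Lemma mean_occ_cst a b : mean_occ nu a = mean_occ nu b.
Proof.
apply: (@cyclic_harmonic_cst R K theta (mean_occ nu) theta0) => {a b} a.
rewrite -[RHS](stat.2 (fun eta => (eta a)%:R)).
under eq_expectation => eta do rewrite generator_occ -mulNr.
by rewrite !expectationD !expectationZ mulNr.
Qed.

(** Since all sites have the same mean occupation, the linear part of
    [generator_occ2] contributes a source that is invariant under
    simultaneous translation of [a] and [b]. *)
Lemma occ_corr_eq a b :
  occ_corr nu (a - 1) b + theta * occ_corr nu (a + 1) b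
  + occ_corr nu a (b - 1) + theta * occ_corr nu a (b + 1)
  - 2 * (1 + theta) * occ_corr nu a b - 2 * p / (N%:R - 1) * occ_corr nu a b
  + ((a == b)%:R * (2 * (1 + theta) + 2 * p * N%:R / (N%:R - 1))
     - hop_kernel theta a b - hop_kernel theta b a) * mean_occ nu 0 = 0.
Proof.
rewrite -[RHS](stat.2 (fun eta => (eta a)%:R * (eta b)%:R)).
under [RHS]eq_expectation => eta do rewrite generator_occ2 -!mulNr.
rewrite !(expectationD, expectationZ) -!/(mean_occ nu _) -!/(occ_corr nu _ _).
rewrite !(mean_occ_cst _ 0).
ring.
Qed.

(** The increment along the diagonal translation solves [occ_corr_eq] without
    its source; the mass [2 p / (N - 1)] is positive, so it vanishes. *)
Lemma occ_corr_shift a b : occ_corr nu (a + 1) (b + 1) = occ_corr nu a b.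
Proof.
apply/eqP; rewrite -subr_eq0; apply/eqP.
have N1 : 0 < N%:R - 1 :> R by rewrite subr_gt0 ltr1n.
pose D a b := occ_corr nu (a + 1) (b + 1) - occ_corr nu a b.
apply: (@massive_harmonic_eq0 R K theta (2 * p / (N%:R - 1)) D) => // [|{}a {}b].
  by rewrite divr_gt0 // mulr_gt0.
have := occ_corr_eq (a + 1) (b + 1); have := occ_corr_eq a b.
rewrite /D /hop_kernel.
have add_sub (x : 'Z_K) : x + 1 - 1 = x - 1 + 1 by rewrite addrAC.
rewrite !add_sub !(inj_eq (addIr _)) => e1 e2.
lra.
Qed.

Lemma occ_corr_sym k : occ_corr nu 0 k = occ_corr nu 0 (- k).
Proof.
have shift n a b : occ_corr nu (a + n%:R) (b + n%:R) = occ_corr nu a b.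
  elim: n => [|n IHn]; first by rewrite !addr0.
  by rewrite -natr1 !addrA occ_corr_shift.
rewrite -(shift (k : nat) 0 (- k)) natr_Zp add0r addNr.
by apply: eq_expectation => eta; rewrite mulrC.
Qed.

End StationaryMoments.

Theorem corollary1p3 (R : realType) (K N : nat) (theta p : R)
    (nu : config K N -> R)
    (hK : (3 <= K)%N) (hN : (2 <= N)%N) (htheta : 0 < theta) (hp : 0 < p)
    (hnu : stationary_distribution theta p nu) (k : 'Z_K) :
  covariance nu (fun eta : config K N => (eta 0)%:R / N%:R)
                (fun eta : config K N => (eta k)%:R / N%:R) =
  covariance nu (fun eta : config K N => (eta 0)%:R / N%:R)
                (fun eta : config K N => (eta (K%:R - k))%:R / N%:R).
Proof.
have -> : K%:R - k = - k by rewrite pchar_Zp ?sub0r // (leq_trans _ hK).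
have scaled_mean a : expectation nu (fun eta => (eta a)%:R / N%:R) =
    N%:R^-1 * mean_occ nu a.
  by rewrite -expectationZ; apply: eq_expectation => eta; rewrite mulrC.
have scaled_corr a b :
    expectation nu (fun eta => (eta a)%:R / N%:R * ((eta b)%:R / N%:R)) =
    N%:R^-1 * N%:R^-1 * occ_corr nu a b.
  by rewrite -expectationZ; apply: eq_expectation => eta; ring.
rewrite !covarianceE; try exact: hnu.1.
rewrite !scaled_mean !scaled_corr (occ_corr_sym htheta hp hN hnu).
by rewrite (mean_occ_cst htheta hnu k (- k)).
Qed.
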